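(* For an arbitrary positive integer $n$ the semigroup $\mathscr{IPF}(\mathbb{N}^n)$ is isomorphic to the semidirect product $\mathscr{S}_n\ltimes_{\Phi}\mathscr{C}(p,q)^n$ of the semigroup $\mathscr{C}(p,q)^n$ by the group $\mathscr{S}_n$.
   Context: $\mathbb{N}$ is the set of positive integers and $\mathbb{N}_0=\mathbb{N}\cup\{0\}$; $(\mathbb{N}^n,\leqslant)$ carries the product (coordinatewise) order; ${\uparrow}\mathbf{x}=\{\mathbf{y}\in\mathbb{N}^n:\mathbf{x}\leqslant\mathbf{y}\}$ is the principal filter generated by $\mathbf{x}$. $\mathscr{IPF}(\mathbb{N}^n)$ is the semigroup of all order isomorphisms between principal filters of $(\mathbb{N}^n,\leqslant)$, with composition of partial maps (maps written on the right, composed left to right, $z(\alpha\beta)=(z\alpha)\beta$ wherever defined). The bicyclic monoid $\mathscr{C}(p,q)$ (the monoid generated by $p,q$ with the relation $pq=1$) is identified with $\mathbb{N}_0\times\mathbb{N}_0$ with operation $(i,j)*(k,l)=(i+\max\{j,k\}-j,\;l+\max\{j,k\}-k)$; $\mathscr{C}(p,q)^n$ is its $n$-th direct power with the coordinatewise operation. For $\mathbf{x}=(x_1,\ldots,x_n)$, $\mathbf{y}=(y_1,\ldots,y_n)$, $[\mathbf{x},\mathbf{y}]$ denotes the element $((x_1,y_1),\ldots,(x_n,y_n))$ of $\mathscr{C}(p,q)^n$. $\mathscr{S}_n$ is the group of permutations of $\{1,\ldots,n\}$ (acting on the right, composed left to right), and $(\mathbf{x})\sigma=(x_{(1)\sigma^{-1}},\ldots,x_{(n)\sigma^{-1}})$.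 The map $\Phi\colon\sigma\mapsto\Phi_\sigma$ is the homomorphism from $\mathscr{S}_n$ to the automorphism group of $\mathscr{C}(p,q)^n$ given by $([\mathbf{x},\mathbf{y}])\Phi_\sigma=[(\mathbf{x})\sigma,(\mathbf{y})\sigma]$. The semidirect product $\mathscr{S}_n\ltimes_\Phi\mathscr{C}(p,q)^n$ is the set $\mathscr{S}_n\times\mathscr{C}(p,q)^n$ with multiplication $(\sigma,a)(\tau,b)=(\sigma\tau,\,(a)\Phi_\tau * b)$. *)

(* Defs.v *)
From HB Require Import structures.
From mathcomp Require Import all_boot all_order all_fingroup.
From mathcomp Require Import boolp classical_sets.
From mathcomp Require Import zify.

Set Implicit Arguments.
Unset Strict Implicit.
Unset Printing Implicit Defensive.

Import Order.Theory.
Local Open Scope classical_set_scope.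
Local Open Scope group_scope.

Section PrincipalFilterIsomorphisms.
Context {d : Order.disp_t} {T : joinSemilatticeType d}.
Implicit Types (x y z : T) (f g h : T -> option T).

Definition principal_filter x : set T := [set y | (x <= y)%O].

Definition pdom f : set T := [set x | exists y, f x = Some y].
Definition pran f : set T := [set y | exists x, f x = Some y].

(* Injectivity of [f] on its domain follows from the third clause, because
   [<=] is antisymmetric. *)
Definition order_iso_between (A B : set T) f : Prop :=
  [/\ pdom f = A, pran f = B &
      forall x y x' y', f x = Some x' -> f y = Some y' ->
        (x <= y)%O = (x' <= y')%O].

Definition is_ipf f : Prop :=
  exists x y, order_iso_between (principal_filter x) (principal_filter y) f.

(* Partial maps compose from left to right: first [f], then [g]. *)
Definition pcomp f g : T -> option T := fun x => obind g (f x).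

Lemma pcompA : associative pcomp.
Proof.
by move=> f g h; apply/funext => x; rewrite /pcomp; case: (f x).
Qed.

Lemma is_ipf_comp f g : is_ipf f -> is_ipf g -> is_ipf (pcomp f g).
Proof.
move=> [x [y [fD fR fO]]] [z [w [gD gR gO]]].
have /= inR u v : f u = Some v -> (y <= v)%O.
  by move=> fu; have : pran f v by [exists u]; rewrite fR.
have /= inD u v : g u = Some v -> (z <= u)%O.
  by move=> gu; have : pdom g u by [exists v]; rewrite gD.
have fS v : (y <= v)%O -> exists u, f u = Some v.
  by move=> yv; have : principal_filter y v by []; rewrite -fR.
have gT u : (z <= u)%O -> exists v, g u = Some v.
  by move=> zu; have : principal_filter z u by []; rewrite -gD.
have [a fa] := fS _ (leUl y z).
have [b gb] := gT _ (leUr z y).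
exists a, b; split.
- apply/seteqP; split => [u [v] | u /= au]; rewrite /pcomp.
    case fu: (f u) => [t|] //= gt.
    rewrite /principal_filter /= (fO _ _ _ _ fa fu) leUx.
    by rewrite (inR _ _ fu) (inD _ _ gt).
  have [t ft] : pdom f u.
    rewrite fD; apply: (le_trans _ au).
    by have : pdom f a; [exists (y `|` z)%O | rewrite fD].
  have zt : (z <= t)%O.
    by apply: (le_trans (leUr z y)); rewrite -(fO _ _ _ _ fa ft).
  have [v gv] := gT _ zt.
  by exists v; rewrite ft.
- apply/seteqP; split => [v [u] | v /= bv]; rewrite /pcomp.
    case fu: (f u) => [t|] //= gt.
    rewrite /principal_filter /= -(gO _ _ _ _ gb gt) leUx.
    by rewrite (inR _ _ fu) (inD _ _ gt).
  have [t gt] : pran g v.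
    rewrite gR; apply: (le_trans _ bv).
    by have : pran g b; [exists (y `|` z)%O | rewrite gR].
  have yt : (y <= t)%O.
    by apply: (le_trans (leUl y z)); rewrite (gO _ _ _ _ gb gt).
  have [u fu] := fS _ yt.
  by exists u; rewrite fu.
- move=> u v u' v'; rewrite /pcomp.
  case fu: (f u) => [s|] //= gs; case fv: (f v) => [t|] //= gt.
  by rewrite (fO _ _ _ _ fu fv) (gO _ _ _ _ gs gt).
Qed.

End PrincipalFilterIsomorphisms.

Record ipf {d : Order.disp_t} (T : joinSemilatticeType d) := Ipf {
  ipf_map :> T -> option T;
  ipf_mapP : is_ipf ipf_map
}.

HB.instance Definition _ d (T : joinSemilatticeType d) := gen_eqMixin (ipf T).
HB.instance Definition _ d (T : joinSemilatticeType d) :=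
  gen_choiceMixin (ipf T).

Section IpfSemigroup.
Context {d : Order.disp_t} {T : joinSemilatticeType d}.
Implicit Types f g h : ipf T.

Lemma ipf_inj f g : ipf_map f = ipf_map g -> f = g.
Proof.
case: f g => [f fP] [g gP] /= fg; rewrite fg in fP *.
by rewrite (Prop_irrelevance fP gP).
Qed.

Definition ipf_mul f g : ipf T := Ipf (is_ipf_comp (ipf_mapP f) (ipf_mapP g)).

Lemma ipf_mulA : associative ipf_mul.
Proof. by move=> f g h; apply: ipf_inj; apply: pcompA. Qed.

HB.instance Definition _ := isSemigroup.Build (ipf T) ipf_mulA.

End IpfSemigroup.

Definition posnat : Type := {k : nat | (0 < k)%N}.
HB.instance Definition _ := SubChoice.on posnat.
HB.instance Definition _ :=
  [SubChoice_isSubOrder of posnat by <: with Order.NatOrder.nat_display].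

(* [n.-tupleprod] carries the coordinatewise order (lemma [leEtprod]). *)
Definition IPF (n : nat) : semigroupType := ipf (n.-tupleprod posnat).

Definition bicyclic : Type := (nat * nat)%type.
HB.instance Definition _ := Choice.on bicyclic.

Definition bicyclic_mul (a b : bicyclic) : bicyclic :=
  let: (i, j) := a in let: (k, l) := b in
  (i + maxn j k - j, l + maxn j k - k)%N.

Lemma bicyclic_mulA : associative bicyclic_mul.
Proof. by move=> [i j] [k l] [r s]; congr (_, _); lia. Qed.

Lemma bicyclic_mul1 : left_id ((0, 0)%N : bicyclic) bicyclic_mul.
Proof. by move=> [k l]; congr (_, _); lia. Qed.

Lemma bicyclic_1mul : right_id ((0, 0)%N : bicyclic) bicyclic_mul.
Proof. by move=> [i j]; congr (_, _); lia. Qed.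

HB.instance Definition _ :=
  isMonoid.Build bicyclic bicyclic_mulA bicyclic_mul1 bicyclic_1mul.

(* The product on [{ffun 'I_n -> bicyclic}] is coordinatewise. *)
Definition bicyclic_pow (n : nat) : monoidType := {ffun 'I_n -> bicyclic}.

Definition brk (n : nat) (x y : {ffun 'I_n -> nat}) : bicyclic_pow n :=
  [ffun i => (x i, y i)].

(* A homomorphism from the group [G] to the automorphisms of [S], which act on
   the right and compose from left to right. *)
Record aut_action (G : groupType) (S : semigroupType) := AutAction {
  aact :> G -> {multiplicative S -> S};
  aact1 : forall a, aact 1 a = a;
  aactM : forall g h a, aact (g * h) a = aact h (aact g a)
}.

Lemma aact_bij (G : groupType) (S : semigroupType) (Phi : aut_action G S)
  (g : G) : bijective (Phi g).
Proof.
by exists (Phi g^-1) => a; rewrite -aactM ?mulgV ?mulVg aact1.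
Qed.

Record semidirect (G : groupType) (S : semigroupType) (Phi : aut_action G S) :=
  Semidirect { sd_left : G; sd_right : S }.

Section SemidirectSemigroup.
Context {G : groupType} {S : semigroupType} {Phi : aut_action G S}.

Definition pair_of_sd (u : semidirect Phi) : G * S := (sd_left u, sd_right u).
Definition sd_of_pair (u : G * S) : semidirect Phi := Semidirect Phi u.1 u.2.
Lemma pair_of_sdK : cancel pair_of_sd sd_of_pair. Proof. by case. Qed.

HB.instance Definition _ :=
  Choice.copy (semidirect Phi) (can_type pair_of_sdK).

Definition sd_mul (u v : semidirect Phi) : semidirect Phi :=
  Semidirect Phi (sd_left u * sd_left v)
                 (Phi (sd_left v) (sd_right u) * sd_right v).

Lemma sd_mulA : associative sd_mul.
Proof.
by move=> [s a] [t b] [r c]; rewrite /sd_mul /= gmulfM aactM !mulgA.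
Qed.

HB.instance Definition _ := isSemigroup.Build (semidirect Phi) sd_mulA.

End SemidirectSemigroup.

Section CoordinatePermutation.
Context {n : nat}.
Implicit Types s t : 'S_n.

Definition permv {A : Type} (s : 'S_n) (x : {ffun 'I_n -> A}) :
  {ffun 'I_n -> A} := [ffun i => x (s^-1 i)].

Definition Phi_fun (s : 'S_n) (a : bicyclic_pow n) : bicyclic_pow n :=
  permv s a.

Lemma Phi_brk s (x y : {ffun 'I_n -> nat}) :
  Phi_fun s (brk x y) = brk (permv s x) (permv s y).
Proof. by apply/ffunP => i; rewrite !ffunE. Qed.

Lemma Phi_funM s : {morph Phi_fun s : a b / a * b}.
Proof. by move=> a b; apply/ffunP => i; rewrite !ffunE. Qed.

HB.instance Definition _ s :=
  isMultiplicative.Build (bicyclic_pow n) (bicyclic_pow n) (Phi_fun s)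
    (@Phi_funM s).

Lemma Phi_fun1 (a : bicyclic_pow n) : Phi_fun 1 a = a.
Proof. by apply/ffunP => i; rewrite !ffunE invg1 perm1. Qed.

Lemma Phi_fun_comp s t (a : bicyclic_pow n) :
  Phi_fun (s * t) a = Phi_fun t (Phi_fun s a).
Proof. by apply/ffunP => i; rewrite !ffunE invMg permM. Qed.

End CoordinatePermutation.

Definition Phi (n : nat) : aut_action 'S_n (bicyclic_pow n) :=
  AutAction (aact := fun s => Phi_fun s) (@Phi_fun1 n) (@Phi_fun_comp n).

Definition semigroup_isomorphic (S T : semigroupType) : Prop :=
  exists f : {multiplicative S -> T}, bijective f.

(* Main.v *)
(** Up to a shift an isomorphism [f] between the filters of [x] and [y] is an
    order automorphism [F] of [nat^n].  Such an [F] preserves the coordinate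
    sum, since strictly increasing maps cannot decrease it and both [F] and its
    inverse are strictly increasing.  Hence [F] permutes the unit vectors,
    [F e_i = e_(s i)], then sends [k e_i] to [k e_(s i)], and is therefore the
    permutation [s] of the coordinates.  So [f] is determined by [s], [x] and
    [y], and it corresponds to [(s, [(x)s, y])] in the semidirect product. *)
Require Import Defs.
From HB Require Import structures.
From mathcomp Require Import all_boot all_order all_fingroup.
From mathcomp Require Import boolp classical_sets.
From mathcomp Require Import zify.

Set Implicit Arguments.
Unset Strict Implicit.
Unset Printing Implicit Defensive.

Import Order.Theory.
Local Open Scope group_scope.

(** * Order automorphisms of the vectors over [nat] *)

Section NatVectors.
Context {n : nat}.
Local Notation vec := {ffun 'I_n -> nat}.
Implicit Types (v w : vec) (i j : 'I_n) (k : nat).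

Definition vle v w : bool := [forall i, (v i <= w i)%N].

Lemma vleP {v w} : reflect (forall i, (v i <= w i)%N) (vle v w).
Proof. exact: forallP. Qed.

Lemma vle_refl v : vle v v.
Proof. exact/vleP. Qed.

Lemma vle_anti v w : vle v w -> vle w v -> v = w.
Proof.
by move=> /vleP vw /vleP wv; apply/ffunP => i; apply/eqP; rewrite eqn_leq vw wv.
Qed.

Definition vsum v : nat := \sum_i v i.

Lemma vsum_lt v w : vle v w -> v != w -> (vsum v < vsum w)%N.
Proof.
move=> /vleP vw neq; have vw' i : true -> (v i <= w i ?= iff (v i == w i))%N.
  by move=> _; split.
have [le eq] := leqif_sum vw'.
rewrite ltn_neqAle [(vsum v <= _)%N]le andbT; apply: contra neq.
rewrite /vsum eq => /forallP h; apply/eqP/ffunP => i; exact/eqP/(h i).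
Qed.

Definition axis k i : vec := [ffun j => if j == i then k else 0%N].

(** Expresses a coordinate through the order alone, so that an order automorphism can be followed on
    coordinates. *)
Lemma vle_axis k i v : vle (axis k i) v = (k <= v i)%N.
Proof.
apply/vleP/idP => [/(_ i) | kv j]; first by rewrite ffunE eqxx.
by rewrite ffunE; case: eqP => [-> |].
Qed.

Lemma axis_le1 j k i : (0 < k)%N -> vle (axis 1 j) (axis k i) = (j == i).
Proof. by move=> k0; rewrite vle_axis ffunE; case: eqP. Qed.

Lemma vsum_axis k i : vsum (axis k i) = k.
Proof.
rewrite /vsum (bigD1 i) //= ffunE eqxx big1 ?addn0 // => j /negPf ji.
by rewrite ffunE ji.
Qed.

Lemma vsum1 v : vsum v = 1%N -> exists i, v = axis 1 i.
Proof.
move=> /eqP /sum_nat_eq1 [i [_ vi v0]]; exists i; apply/ffunP => j.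
by rewrite ffunE; case: eqP => [-> // | /eqP ji]; apply: v0.
Qed.

(** Induction on the sum of [v]: removing one unit vector below [v] gives [w] with sum one less, and
    [F w] lies strictly below [F v] by injectivity, so the sum of [F v] exceeds that of [F w]. *)
Lemma vsum_incr (F : vec -> vec) :
  injective F -> (forall v w, vle v w -> vle (F v) (F w)) ->
  forall v, (vsum v <= vsum (F v))%N.
Proof.
move=> Finj Fmon v; move: {2}(vsum v) (erefl (vsum v)) => m.
elim: m v => [|m IHm] v vm; first by rewrite vm.
have [i vi] : exists i, (0 < v i)%N.
  apply/existsP; rewrite -[X in is_true X]negbK negb_exists.
  apply/negP => /forallP v0.
  by move: vm; rewrite /vsum big1 // => i _; apply/eqP; rewrite -leqn0 leqNgt.
pose w : vec := [ffun j => (v j - axis 1 i j)%N].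
have wv : vle w v by apply/vleP => j; rewrite ffunE leq_subr.
have wm : vsum w = m.
  apply: succn_inj; rewrite -vm -[RHS](@subnK (vsum (axis 1 i))) ?vsum_axis.
    rewrite addn1 -[in RHS](vsum_axis 1 i) /vsum -sumnB => [|j _].
      by congr _.+1; apply: eq_bigr => j _; rewrite ffunE.
    by rewrite ffunE; case: eqP => [-> |].
  by rewrite vm.
have neq : w != v by apply: contra_eq_neq vm => <-; rewrite wm neq_ltn ltnSn.
rewrite vm -wm; apply: (leq_ltn_trans (IHm _ wm)).
by apply: vsum_lt; [exact: Fmon | rewrite (inj_eq Finj)].
Qed.

Lemma vec_automorphism (F G : vec -> vec) :
  cancel F G -> cancel G F -> (forall v w, vle v w = vle (F v) (F w)) ->
  exists s : 'S_n, forall v i, F v (s i) = v i.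
Proof.
move=> FK GK Fle.
have Fsum v : vsum (F v) = vsum v.
  apply/eqP; rewrite eqn_leq (@vsum_incr F (can_inj FK)) => [|u w]; last first.
    by rewrite Fle.
  rewrite -[in X in (_ <= X)%N](FK v) (@vsum_incr G (can_inj GK)) => // u w.
  by rewrite (Fle (G u)) !GK.
have Fatom i : exists j, F (axis 1 i) = axis 1 j.
  by apply: vsum1; rewrite Fsum vsum_axis.
have [r Fr] := choice Fatom.
have rinj : injective r.
  move=> i j rij; have /(can_inj FK) ij : F (axis 1 i) = F (axis 1 j).
    by rewrite !Fr rij.
  by apply/eqP; rewrite -(axis_le1 i j (ltnSn 0)) ij vle_refl.
pose s := perm rinj; exists s.
have Fs i : F (axis 1 i) = axis 1 (s i) by rewrite permE.
(* The only unit vector that can lie below [axis k i] is that of [i], so its image vanishes off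
   [s i]; the preserved sum then forces the value [k] there. *)
have Faxis k i : F (axis k i) = axis k (s i).
  have off j : j != s i -> F (axis k i) j = 0%N.
    move=> ji; apply/eqP; rewrite -leqn0 leqNgt -vle_axis -(permKV s j) -Fs -Fle.
    rewrite vle_axis ffunE; case: eqP => // ij.
    by rewrite -ij permKV eqxx in ji.
  have on : F (axis k i) (s i) = k.
    have := Fsum (axis k i); rewrite vsum_axis /vsum (bigD1 (s i)) //= big1 => [|j].
      by rewrite addn0.
    exact: off.
  by apply/ffunP => j; rewrite [RHS]ffunE; case: eqP => [-> // | /eqP /off].
(* Two naturals with the same lower bounds are equal. *)
have le k v i : (k <= F v (s i))%N = (k <= v i)%N.
  by rewrite -!vle_axis -Faxis -Fle.
by move=> v i; apply/eqP; rewrite eqn_leq -le leqnn le leqnn.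
Qed.

End NatVectors.

(** * Passage from positive vectors to coordinates starting at zero *)

Section PositiveVectors.
Context {n : nat}.
Local Notation vec := {ffun 'I_n -> nat}.
Local Notation pvec := (n.-tupleprod posnat).
Implicit Types (u : pvec) (v w : vec).

(* Coordinates are shifted by one, so that they start at [0].  The lock keeps
   [ffunE] from unfolding [coords]. *)
Definition coords u : vec := locked [ffun i => (val (tnth u i)).-1].

Lemma coordsE u i : coords u i = (val (tnth u i)).-1.
Proof. by rewrite /coords -lock ffunE. Qed.

Definition of_coords v : pvec :=
  [tuple (exist _ (v i).+1 (ltn0Sn (v i)) : posnat) | i < n].

Lemma coordsK : cancel coords of_coords.
Proof.
move=> u; apply: eq_from_tnth => i; rewrite tnth_mktuple; apply: val_inj => /=.
by rewrite coordsE prednK //; case: (tnth u i).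
Qed.

Lemma of_coordsK : cancel of_coords coords.
Proof. by move=> v; apply/ffunP => i; rewrite coordsE tnth_mktuple. Qed.

Lemma le_coords (u u' : pvec) : (u <= u')%O = vle (coords u) (coords u').
Proof.
rewrite leEtprod; apply: eq_forallb => i; rewrite !coordsE leEsub leEnat.
by case: (tnth u i) (tnth u' i) => [[|k] //= _] [[|l] //= _].
Qed.

End PositiveVectors.

(** * Normal form of the isomorphisms between principal filters *)

Section ShiftPermutations.
Context {n : nat}.
Local Notation vec := {ffun 'I_n -> nat}.
Local Notation pvec := (n.-tupleprod posnat).
Implicit Types (s t : 'S_n) (a b : bicyclic_pow n) (u : pvec).

(* [u |-> (u)s - p + q], defined when [p <= (u)s], for [a = [p, q]]. *)
Definition shift_perm s a : pvec -> option pvec := fun u =>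
  if [forall i, ((a i).1 <= permv s (coords u) i)%N]
  then Some (of_coords [ffun i => (permv s (coords u) i - (a i).1 + (a i).2)%N])
  else None.

(** Indexing by [s i] removes the inverse permutation hidden in [permv]. *)
Variant shift_perm_spec s a u : option pvec -> Prop :=
| ShiftPermSome u' of
    (forall i, ((a (s i)).1 <= coords u i)%N) &
    (forall i, coords u' (s i) = (coords u i - (a (s i)).1 + (a (s i)).2)%N) :
    shift_perm_spec s a u (Some u')
| ShiftPermNone i of (coords u i < (a (s i)).1)%N : shift_perm_spec s a u None.

Lemma shift_permP s a u : shift_perm_spec s a u (shift_perm s a u).
Proof.
rewrite /shift_perm; case: ifPn => [/forallP ok | ].
  constructor=> i; first by have := ok (s i); rewrite ffunE permK.
  by rewrite of_coordsK !ffunE permK.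
rewrite negb_forall => /existsP[i]; rewrite -ltnNge ffunE => lt.
by apply: (@ShiftPermNone _ _ _ (s^-1 i)); rewrite permKV.
Qed.

Lemma shift_perm_eq s a u u' :
    (forall i, ((a (s i)).1 <= coords u i)%N) ->
    (forall i, coords u' (s i) = (coords u i - (a (s i)).1 + (a (s i)).2)%N) ->
  shift_perm s a u = Some u'.
Proof.
move=> ok eq; case: shift_permP => [w _ weq | i]; last by rewrite ltnNge ok.
congr Some; apply: (can_inj coordsK); apply/ffunP => i.
by rewrite -(permKV s i) weq eq.
Qed.

Lemma shift_perm_ipf s a : is_ipf (shift_perm s a).
Proof.
(* For [a = [p, q]], [x] is the least [u] with [p <= (u)s], and its image is [y]. *)
pose x : pvec := of_coords [ffun i => (a (s i)).1].
pose y : pvec := of_coords [ffun i => (a i).2].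
have xle u : (x <= u)%O = [forall i, ((a (s i)).1 <= coords u i)%N].
  by rewrite le_coords of_coordsK; apply: eq_forallb => i; rewrite ffunE.
have yle u : (y <= u)%O = [forall i, ((a i).2 <= coords u i)%N].
  by rewrite le_coords of_coordsK; apply: eq_forallb => i; rewrite ffunE.
exists x, y; split.
- apply/seteqP; split => u; rewrite /principal_filter /pdom /= xle.
    by case=> u'; case: shift_permP => // w /forallP.
  move=> /forallP xu; case: shift_permP => [w _ _ | i]; first by exists w.
  by rewrite ltnNge xu.
- apply/seteqP; split => u'; rewrite /principal_filter /pran /= yle.
    case=> u; case: shift_permP => // w _ weq [<-]; apply/forallP => i.
    by rewrite -(permKV s i) weq leq_addl.
  move=> /forallP yu.
  (* The preimage undoes the permutation and the shift; the truncated subtraction is exact because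
     [q] is below [u']. *)
  exists (of_coords [ffun i => coords u' (s i) - (a (s i)).2 + (a (s i)).1])%N.
  apply: shift_perm_eq => i; rewrite of_coordsK ffunE ?leq_addl //.
  by rewrite addnK subnK.
- move=> u v u' v'.
  case: shift_permP => // w uok weq [<-]; case: shift_permP => // z vok zeq [<-].
  rewrite !le_coords; apply/vleP/vleP => h i.
    rewrite -(permKV s i) weq zeq; have := h (s^-1 i); lia.
  have := h (s i); rewrite weq zeq; have := uok i; have := vok i; lia.
Qed.

(** At a coordinate [c], the shifts by [(p, q)] and then [(k, l)] are both defined iff
    [p + maxn q k - q <= c], and they give [c - p + q - k + l]: this is the bicyclic product. *)
Lemma shift_permM s t a b :
  shift_perm (s * t) (Phi_fun t a * b) = Defs.pcomp (shift_perm s a) (shift_perm t b).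
Proof.
have mulE i : (Phi_fun t a * b) ((s * t) i) =
    bicyclic_mul (a (s i)) (b (t (s i))).
  by rewrite permM !ffunE permK.
apply/funext => u; rewrite /Defs.pcomp; case: (shift_permP s a u) => [v vok veq | i ilt] /=.
  case: (shift_permP t b v) => [w wok weq | i ilt].
    apply: shift_perm_eq => i; rewrite mulE ?permM ?weq ?veq;
    have := vok i; have := wok (s i); rewrite veq;
    by case: (a (s i)) (b (t (s i))) => [p q] [k l] /=; lia.
  case: shift_permP => // w wok; have := wok (s^-1 i); rewrite mulE.
  have := vok (s^-1 i); have := veq (s^-1 i); rewrite permKV; move: ilt.
  by case: (a i) (b (t i)) => [p q] [k l] /=; lia.
case: shift_permP => // w wok; have := wok i; rewrite mulE; move: ilt.
by case: (a (s i)) (b (t (s i))) => [p q] [k l] /=; lia.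
Qed.

(** The least point of the first domain also lies in the second. Used in both directions, this
    identifies the domains. *)
Lemma shift_perm_min s t a b :
    (forall u, shift_perm s a u = shift_perm t b u) ->
  forall i, ((b (t i)).1 <= (a (s i)).1)%N.
Proof.
move=> ab; pose u : pvec := of_coords [ffun i => (a (s i)).1].
case: (shift_permP s a u) (ab u) => [w _ _ | i]; last first.
  by rewrite of_coordsK ffunE ltnn.
by case: shift_permP => // z ok _ _ i; have := ok i; rewrite of_coordsK ffunE.
Qed.

Lemma shift_perm_inj s t a b :
  shift_perm s a = shift_perm t b -> s = t /\ a = b.
Proof.
move=> /(congr1 (fun f => f _)) /= ab.
have p_eq i : (a (s i)).1 = (b (t i)).1.
  by apply/eqP; rewrite eqn_leq !shift_perm_min.
pose at_ (v : vec) : pvec := of_coords [ffun i => (a (s i)).1 + v i]%N.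
(* The common image [w] of the point [v] above the least point of the domain, computed from either
   side. *)
have vals (v : vec) : exists w : vec, forall i,
    w (s i) = (v i + (a (s i)).2)%N /\ w (t i) = (v i + (b (t i)).2)%N.
  case: (shift_permP s a (at_ v)) (ab (at_ v)) => [w _ weq | i]; last first.
    by rewrite of_coordsK ffunE; lia.
  case: shift_permP => // z _ zeq [wz]; exists (coords w) => i.
  by rewrite weq {}wz zeq of_coordsK !ffunE p_eq !addKn.
(* The image of the least point yields [q]. *)
have [w0 w0E] := vals ([ffun=> 0%N] : vec).
have q_s i : (a (s i)).2 = w0 (s i) by have [-> _] := w0E i; rewrite ffunE.
have q_t i : (b (t i)).2 = w0 (t i) by have [_ ->] := w0E i; rewrite ffunE.
have st : s = t.
  (* Raising coordinate [i] by one raises the image only at [s i], and also only at [t i]. *)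
  apply/permP => i; have [w wE] := vals (axis 1 i); apply/eqP/negPn/negP => neq.
  have [_] := wE i; rewrite q_t -(permKV s (t i)); have [-> _] := wE (s^-1 (t i)).
  rewrite q_s !ffunE eqxx; case: eqP => [ti |]; last by lia.
  by move: neq; rewrite -{1}ti permKV eqxx.
split=> //; rewrite {}st in p_eq q_s; apply/ffunP => i; rewrite -(permKV t i).
by rewrite [LHS]surjective_pairing [RHS]surjective_pairing p_eq q_s q_t.
Qed.

Lemma ipf_shift_perm (f : pvec -> option pvec) :
  is_ipf f -> exists s a, f = shift_perm s a.
Proof.
move=> [x [y [fD fR fO]]].
(* [above z] identifies all vectors over [nat] with the filter of [z], turning [f] into the
   automorphism [F]. *)
pose above (z : pvec) (v : vec) : pvec := of_coords [ffun i => coords z i + v i]%N.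
have le_above z v : (z <= above z v)%O.
  by rewrite le_coords of_coordsK; apply/vleP => i; rewrite ffunE leq_addr.
have aboveP z u : (z <= u)%O -> exists v, u = above z v.
  rewrite le_coords => /vleP zu; exists [ffun i => coords u i - coords z i]%N.
  rewrite -[LHS]coordsK; congr of_coords; apply/ffunP => i.
  by rewrite !ffunE subnKC // (zu i).
have above_le z v w : (above z v <= above z w)%O = vle v w.
  rewrite le_coords !of_coordsK; apply: eq_forallb => i.
  by rewrite !ffunE leq_add2l.
have dom v : exists w, f (above x v) = Some (above y w).
  have [u fu] : pdom f (above x v) by rewrite fD; apply: le_above.
  have /aboveP[w uw] : principal_filter y u by rewrite -fR; exists (above x v).
  by exists w; rewrite -uw.
have ran w : exists v, f (above x v) = Some (above y w).
  have [u fu] : pran f (above y w) by rewrite fR; apply: le_above.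
  have /aboveP[v uv] : principal_filter x u by rewrite -fD; exists (above y w).
  by exists v; rewrite -uv.
have [F FE] := choice dom; have [G GE] := choice ran.
have rel v w v' w' : f (above x v) = Some (above y v') ->
    f (above x w) = Some (above y w') -> vle v w = vle v' w'.
  by move=> fv fw; rewrite -(above_le x) (fO _ _ _ _ fv fw) above_le.
(* [v] and [G (F v)] have the same image under [f], which reflects the order. *)
have FK : cancel F G.
  move=> v; apply: vle_anti; last by rewrite (rel _ _ _ _ (FE _) (GE _)) vle_refl.
  by rewrite (rel _ _ _ _ (GE _) (FE _)) vle_refl.
have GK : cancel G F.
  move=> v; apply: vle_anti; last by rewrite -(rel _ _ _ _ (GE _) (FE _)) vle_refl.
  by rewrite -(rel _ _ _ _ (FE _) (GE _)) vle_refl.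
have [s sE] := vec_automorphism FK GK (fun v w => rel _ _ _ _ (FE v) (FE w)).
exists s, (brk (permv s (coords x)) (coords y)); apply/funext => u.
have [xu | xu] := boolP (x <= u)%O.
  have [v ->] := aboveP _ _ xu; rewrite FE; apply/esym/shift_perm_eq => i.
    by rewrite of_coordsK !ffunE permK leq_addr.
  by rewrite !of_coordsK !ffunE permK sE addKn addnC.
case fu: (f u) => [u'|].
  have : pdom f u by exists u'.
  by rewrite fD /principal_filter /= (negPf xu).
case: shift_permP => // w ok _; case/negP: xu; rewrite le_coords.
by apply/vleP => i; have := ok i; rewrite !ffunE permK.
Qed.

End ShiftPermutations.

(** * Assembling the isomorphism with the semidirect product *)

Theorem theorem2p20 (n : nat) (hn : (0 < n)%N) :
  semigroup_isomorphic (IPF n) (semidirect (Phi n)).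
Proof.
pose psi (u : semidirect (Phi n)) : IPF n :=
  Ipf (shift_perm_ipf (sd_left u) (sd_right u)).
have psiM u v : psi (u * v) = psi u * psi v.
  by apply: ipf_inj; apply: shift_permM.
have psi_inj : injective psi.
  by move=> [s a] [t b] /(congr1 (@ipf_map _ _)) /= /shift_perm_inj[-> ->].
have psi_surj f : exists u, psi u = f.
  have [s [a fE]] := ipf_shift_perm (ipf_mapP f).
  by exists (Semidirect (Phi n) s a); apply: ipf_inj.
(* The isomorphism is sought out of [IPF n], so the inverse of [psi] is chosen; it is multiplicative
   because [psi] is multiplicative and injective. *)
have [phi phiK] := choice psi_surj.
have psiK : cancel psi phi by move=> u; apply: psi_inj; rewrite phiK.
have phiM : {morph phi : f g / f * g}.
  by move=> f g; apply: psi_inj; rewrite psiM !phiK.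
pose phi_mult := isMultiplicative.Build (IPF n) (semidirect (Phi n)) phi phiM.
pose phi' : {multiplicative IPF n -> semidirect (Phi n)} := HB.pack phi phi_mult.
by exists phi'; exists psi.
Qed.
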